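(* (i) There is a constant $C_1>0$ such that, for $0<d\le n/2$, any triangle-free graph $G$ on $n$ vertices with minimum degree at least $d$ has fractional chromatic number at most $\min\{C_1\sqrt{n/\log n},\, \chi_f(G^3)/d\}$. (ii) Any triangle-free graph $G$ on $n\ge2$ vertices with $m\ge1$ edges and $w_3$ directed three-edge walks contains a bipartite induced subgraph of minimum degree at least $w_3/(4\chi_f(G^3)m)$; and if moreover $G$ has minimum degree at least $d$, then $G$ contains a bipartite induced subgraph of minimum degree at least $d^2/(2\chi_f(G^3))$.
   Context: For a graph $G$, the cube $G^3$ is the simple graph on $V(G)$ in which two distinct vertices are adjacent iff they are joined by a path of length at most $3$ in $G$. $\chi_f$ denotes fractional chromatic number: the smallest $k$ such that there is a probability distribution over stable sets under which every vertex lies in the random stable set with probability at least $1/k$. A directed three-edge walk is a sequence $(v_0,v_1,v_2,v_3)$ with each $v_{i-1}v_i$ an edge. A bipartite induced subgraph is a subgraph induced by a nonempty vertex set which is bipartite. $\log$ is the natural logarithm. *)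

(* Defs.v *)
From mathcomp Require Import all_boot all_order all_algebra.
From mathcomp Require Import classical_sets reals exp.

Set Implicit Arguments.
Unset Strict Implicit.
Unset Printing Implicit Defensive.

Import Order.TTheory GRing.Theory Num.Theory.
Local Open Scope ring_scope.

Record sgraph := SGraph {
  vertex :> finType;
  adj : rel vertex;
  adj_sym : symmetric adj;
  adj_irrefl : irreflexive adj }.

Section Graph.
Variable G : sgraph.
Implicit Types (x y : G) (S : {set G}).

Definition triangle_free : Prop :=
  forall x y z : G, ~~ [&& adj x y, adj y z & adj x z].

Definition stable S : bool := [forall x in S, forall y in S, ~~ adj x y].

Definition bipartite : Prop :=
  exists A : {set G}, stable A /\ stable (~: A).

Definition degree x : nat := #|[set y | adj x y]|.

Definition edges : {set {set G}} :=
  [set [set p.1; p.2] | p : G * G & adj p.1 p.2].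

(* Vertices may repeat: (v0,v1,v0,v1) is counted for every edge v0v1. *)
Definition walks3 : {set 4.-tuple G} := [set w : 4.-tuple G | sorted (@adj G) w].

(* A path of length k from x is x :: p with p a k-tuple. *)
Definition cube_adj x y : bool :=
  (x != y) && [exists k : 'I_4, exists p : k.-tuple G,
    [&& path (@adj G) x p, last x p == y & uniq (x :: p)]].

Lemma cube_adj_sym : symmetric cube_adj.
Proof.
suff H x y : cube_adj x y -> cube_adj y x.
  by move=> x y; apply/idP/idP; apply: H.
case/andP=> nxy /existsP[k /existsP[p /and3P[xp /eqP py up]]].
rewrite /cube_adj eq_sym nxy /=; apply/existsP; exists k; apply/existsP.
have sz : size (rev (belast x p)) == k by rewrite size_rev size_belast size_tuple.
have E : y :: rev (belast x p) = rev (x :: p).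
  by rewrite (lastI x) py rev_rcons.
exists (Tuple sz); rewrite /= -[_ && uniq _]/(uniq (y :: rev (belast x p))).
apply/and3P; split.
- rewrite -py rev_path; rewrite (eq_path (e' := @adj G)) // => u v.
  exact: adj_sym.
- case: (val p) E => [|a s] E; first by case: E => ->.
  by rewrite /= rev_cons last_rcons.
- by rewrite E rev_uniq.
Qed.

Lemma cube_adj_irrefl : irreflexive cube_adj.
Proof. by move=> x; rewrite /cube_adj eqxx. Qed.

Definition cube : sgraph := SGraph cube_adj_sym cube_adj_irrefl.

Definition induced_adj S : rel {x : G | x \in S} :=
  fun u v => adj (val u) (val v).

Lemma induced_adj_sym S : symmetric (@induced_adj S).
Proof. by move=> u v; apply: adj_sym. Qed.

Lemma induced_adj_irrefl S : irreflexive (@induced_adj S).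
Proof. by move=> u; apply: adj_irrefl. Qed.

Definition induced S : sgraph :=
  SGraph (@induced_adj_sym S) (@induced_adj_irrefl S).

Section Real.
Variable R : realType.

Definition min_degree_ge (d : R) : Prop := forall x, d <= (degree x)%:R.

Definition stable_distribution (mu : {set G} -> R) : Prop :=
  [/\ forall S, 0 <= mu S,
      forall S, ~~ stable S -> mu S = 0
    & \sum_(S : {set G}) mu S = 1].

Definition fractionally_colourable (k : R) : Prop :=
  0 < k /\ exists mu : {set G} -> R, stable_distribution mu /\
    forall x, k^-1 <= \sum_(S : {set G} | x \in S) mu S.

(* If G has a vertex, this infimum is a minimum, as the optimum of a finite
   linear program; it is 0 if G has no vertex. *)
Definition fchi : R := inf [set k : R | fractionally_colourable k]%classic.

End Real.
End Graph.

Arguments fchi G R : clear implicits.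

Definition has_bipartite_induced_subgraph (R : realType) (G : sgraph) (d : R) :
    Prop :=
  exists S : {set G},
    [/\ (0 < #|S|)%N, bipartite (induced S) & min_degree_ge (induced S) d].

(* Main.v *)
(* (i) If S is stable in G^3 and G is triangle-free, then N(S) is stable in G and
   each of its vertices has exactly one neighbour in S. So neighbourhoods of
   random stable sets of G^3 colour G fractionally, with a gain of d.
   For the bound in n alone, neighbourhoods of high degree are used as single
   colours; the remaining graph of maximum degree D is coloured greedily by
   uniform random stable subsets of the unsaturated vertices. For such a set I,
   every vertex v has a P(v in I) + b E|N(v) n I| >= 1 with a = 2^L + 1 and
   b = 4 / L, so the greedy process ends by time a + b D.
   (ii) If M is the largest minimum degree of a bipartite induced subgraph, then
   stable sets A, B span at most M (|A| + |B|) edges. Take A = N(S), B = N(T) for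
   independent random stable sets S, T of G^3, and compare expectations. *)
Require Import Defs.
From mathcomp Require Import all_boot all_order all_algebra.
From mathcomp Require Import classical_sets reals exp.
From mathcomp Require Import fintype finset ring lra.

Set Implicit Arguments.
Unset Strict Implicit.
Unset Printing Implicit Defensive.

Import Order.TTheory GRing.Theory Num.Theory.
Local Open Scope ring_scope.

(** * Local occupancy of uniform random stable sets in triangle-free graphs *)

(** Pair each [B] with [J :\: B]: the two sizes add up to [#|J|]. *)
Lemma sum_card_subsets (T : finType) (J : {set T}) :
  (2 * \sum_(B : {set T} | B \subset J) #|B| = #|J| * 2 ^ #|J|)%N.
Proof.
rewrite mul2n -addnn {2}(reindex_onto (setD J) (setD J)) /=; last first.
  by move=> B BJ; rewrite setDDr setDv set0U; apply/setIidPr.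
rewrite [X in (_ + X)%N](eq_bigl (fun B : {set T} => B \subset J)); last first.
  move=> B; rewrite subsetDl setDDr setDv set0U andTb.
  by apply/eqP/idP => [<-|/setIidPr //]; apply: subsetIl.
rewrite -big_split /= -card_powerset mulnC -sum_nat_const.
apply: eq_big => [B|B BJ]; first by rewrite powersetE.
by rewrite cardsDS // subnKC // subset_leq_card.
Qed.

Section Nbr.
Variable G : sgraph.
Implicit Types (x y : G) (A B S U W : {set G}).

Definition nbr x : {set G} := [set y | adj x y].

Lemma in_nbr x y : (y \in nbr x) = adj x y.
Proof. by rewrite inE. Qed.

Lemma stableP S :
  reflect (forall x y, x \in S -> y \in S -> ~~ adj x y) (stable S).
Proof.
apply: (iffP forallP) => [H x y xS yS | H x].
  by move/forallP: (implyP (H x) xS) => /(_ y); rewrite yS.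
by apply/implyP=> xS; apply/forallP=> y; apply/implyP=> yS; apply: H.
Qed.

Lemma stable_sub A B : A \subset B -> stable B -> stable A.
Proof.
by move=> /subsetP AB /stableP sB; apply/stableP=> x y /AB xB /AB; apply: sB.
Qed.

Lemma stable1 x : stable [set x].
Proof. by apply/stableP=> ? ? /set1P-> /set1P->; rewrite adj_irrefl. Qed.

Lemma stable_nbr x : triangle_free G -> stable (nbr x).
Proof.
move=> tf; apply/stableP=> y z; rewrite !in_nbr => xy xz.
by apply: contra (tf x y z) => yz; rewrite xy yz xz.
Qed.

Section Occupancy.
Variables (R : realType) (a b : R).
Hypothesis occ : forall x : nat, (2 ^ x)%:R + 1 <= a + b / 2 * (x * 2 ^ x)%:R.

(* Condition on the trace A of S outside the closed neighbourhood of v: then S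
   is either A + v or A + B, where B is any set of neighbours of v in U with no
   neighbour in A. *)
Lemma occupancy U (v : G) : triangle_free G -> v \in U ->
  \sum_(S : {set G} | stable S && (S \subset U)) (1 : R) <=
  \sum_(S : {set G} | stable S && (S \subset U))
     (a * (v \in S)%:R + b * #|S :&: nbr v|%:R).
Proof.
move=> tf vU; pose N := v |: nbr v.
rewrite -subr_ge0 -sumrB (partition_big (fun S => S :\: N) xpredT) //=.
apply: sumr_ge0 => A _.
case: (pickP (fun S => stable S && (S \subset U) && (S :\: N == A))); last first.
  by move=> no; rewrite big_pred0.
move=> S0 /andP[/andP[sS0 S0U] /eqP defA].
have AS0 : A \subset S0 by rewrite -defA subsetDl.
have AU := subset_trans AS0 S0U.
have sA := stable_sub AS0 sS0.
have AN : [disjoint A & N] by rewrite -defA disjoints_subset setDE subsetIr.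
have AnotN x : x \in A -> x \notin N by move=> xA; rewrite (disjointFr AN xA).
have vA : v \notin A by apply: contraL (setU11 v (nbr v)) => /AnotN.
pose J := [set u in nbr v | (u \in U) && [forall w in A, ~~ adj u w]].
have JN : J \subset nbr v by apply/subsetP=> u; rewrite inE => /andP[].
have vn : v \notin nbr v by rewrite in_nbr adj_irrefl.
rewrite (bigD1 (v |: A)) /=; last first.
  apply/andP; split; last first.
    apply/eqP/setP=> x; rewrite in_setD in_setU1.
    case: (boolP (x \in N)) => [xN | xN] /=.
      by apply/esym/negbTE; apply: contraL xN => /AnotN.
    by case: eqP xN => // ->; rewrite setU11.
  apply/andP; split; last by rewrite subUset sub1set vU.
  apply/stableP=> x y; rewrite !in_setU1.
  case/orP=> [/eqP-> | xA] /orP[/eqP-> | yA].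
  - by rewrite adj_irrefl.
  - by move: (AnotN y yA); rewrite in_setU1 negb_or in_nbr => /andP[].
  - by move: (AnotN x xA); rewrite in_setU1 negb_or in_nbr adj_sym => /andP[].
  - exact: (stableP _ sA).
have AJ0 : A :&: nbr v = set0.
  apply/setP=> x; rewrite in_set0 in_setI; apply/negbTE/negP => /andP[/AnotN].
  by rewrite in_setU1 negb_or => /andP[_ /negbTE->].
(* A stable set containing [v] has no neighbour of [v], so [v |: A] is the only such set in the
   block; every other set is recovered from its trace on [nbr v]. *)
rewrite (reindex_onto (fun B => A :|: B) (fun S => S :&: nbr v)) /=; last first.
  move=> S /andP[/andP[/andP[sS SU] /eqP SA] nS].
  apply/setP=> x; rewrite in_setU in_setI -SA in_setD in_setU1 negb_or.
  case: (boolP (x \in S)) => xS; rewrite ?andbF //= ?andbT.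
  case: (boolP (x \in nbr v)) => xv; rewrite ?andbT ?orbT //= orbF.
  apply: contraNneq nS => xEv; subst x; apply/eqP/setP=> z.
  rewrite -SA in_setU1 in_setD in_setU1 negb_or.
  case: eqP => [->|_] //=; case: (boolP (z \in S)) => zS; rewrite ?andbF //= andbT.
  by rewrite in_nbr (stableP _ sS).
rewrite (eq_bigl (fun B => B \subset J)); last first.
  move=> B; apply/idP/idP.
    case/andP=> /andP[/andP[/andP[sAB ABU] /eqP defAB] nv] /eqP defB.
    apply/subsetP=> x; rewrite -defB in_setI => /andP[xAB xv].
    rewrite inE xv (subsetP ABU) //=; apply/forallP=> w; apply/implyP=> wA.
    by apply: (stableP _ sAB) => //; rewrite in_setU wA.
  move=> BJ; have BN := subset_trans BJ JN.
  have sAB : stable (A :|: B).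
    have crs u w : u \in B -> w \in A -> ~~ adj u w.
      move=> /(subsetP BJ); rewrite inE => /and3P[_ _ /forallP/(_ w)/implyP]; exact.
    apply/stableP=> x y; rewrite !in_setU => /orP[xA|xB] /orP[yA|yB].
    - exact: (stableP _ sA).
    - by rewrite adj_sym crs.
    - exact: crs.
    - by move/stableP: (stable_nbr v tf); apply; apply: (subsetP BN).
  rewrite sAB subUset AU /=; apply/andP; split; last first.
    by rewrite setIUl AJ0 set0U; apply/eqP/setIidPl.
  apply/andP; split; last first.
    apply/eqP=> /setP/(_ v); rewrite setU11 in_setU (negbTE vA) /= => vB.
    by move: vn; rewrite (subsetP BN).
  apply/andP; split; first by apply/subsetP=> x /(subsetP BJ); rewrite inE => /and3P[].
  apply/eqP/setP=> x; rewrite in_setD in_setU.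
  case: (boolP (x \in A)) => [/AnotN->//|_] /=.
  apply/negbTE; rewrite negb_and negbK; case: (boolP (x \in B)) => [|_]; rewrite ?orbT //.
  by move=> /(subsetP BN) xN; rewrite in_setU1 xN orbT.
have -> : (v |: A) :&: nbr v = set0.
  by rewrite setIUl AJ0 setU0; apply/eqP; rewrite setI_eq0 disjoints1.
rewrite (eq_bigr (fun B => b * #|B|%:R - 1)); last first.
  move=> B BJ; have BN := subset_trans BJ JN.
  rewrite setIUl AJ0 set0U (setIidPl BN) in_setU (negbTE vA) /=.
  have -> : (v \in B) = false by apply/negbTE; apply: contra vn => /(subsetP BN).
  by rewrite mulr0 add0r.
rewrite sumrB -mulr_sumr -natr_sum setU11 cards0 mulr0 mulr1 addr0.
have -> : \sum_(B : {set G} | B \subset J) (1 : R) = (2 ^ #|J|)%:R.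
  rewrite -card_powerset -sumr_const; apply: eq_bigl => B.
  by rewrite powersetE.
(* The block contributes [a - 1] from [v |: A] and [b * #|B| - 1] from each [A :|: B], which is
   nonnegative in total by [occ] at [#|J|]. *)
have := occ #|J|; rewrite -sum_card_subsets natrM.
by lra.
Qed.
End Occupancy.

(** * Fractional covers by weighted stable sets *)

Section Covers.
Variable R : realType.
Implicit Types (mu : {set G} -> R) (T : R).

Definition mass mu : R := \sum_(S : {set G}) mu S.
Definition cov mu x : R := \sum_(S : {set G} | x \in S) mu S.
Definition stable_measure mu : Prop :=
  (forall S, 0 <= mu S) /\ (forall S, ~~ stable S -> mu S = 0).
(** An unnormalised fractional colouring: total weight [T] and coverage 1 replace probability 1 and
    coverage [T^-1], so that colours can simply be added. *)
Definition covers W T : Prop :=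
  exists mu, [/\ stable_measure mu, mass mu = T & forall x, x \in W -> 1 <= cov mu x].

Lemma covE mu x : cov mu x = \sum_(S : {set G}) mu S * (x \in S)%:R.
Proof.
rewrite /cov big_mkcond; apply: eq_bigr => S _.
by case: (x \in S); rewrite ?mulr1 ?mulr0.
Qed.

Lemma sum_cov mu A : \sum_(u in A) cov mu u = \sum_(S : {set G}) mu S * #|S :&: A|%:R.
Proof.
under eq_bigr do rewrite covE.
rewrite exchange_big; apply: eq_bigr => S _ /=.
rewrite -mulr_sumr -natr_sum setIC -sum1_card; congr (_ * _%:R).
rewrite [RHS](eq_bigl (fun u => (u \in A) && (u \in S))) => [|u]; last by rewrite inE.
by rewrite big_mkcondr; apply: eq_bigr => u _; case: (u \in S).
Qed.

Lemma massD mu nu (e : R) : mass (fun S => mu S + e * nu S) = mass mu + e * mass nu.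
Proof. by rewrite /mass big_split /= mulr_sumr. Qed.

Lemma covD mu nu (e : R) x : cov (fun S => mu S + e * nu S) x = cov mu x + e * cov nu x.
Proof. by rewrite /cov big_split /= mulr_sumr. Qed.

Lemma stable_measureD mu nu (e : R) : 0 <= e -> stable_measure mu -> stable_measure nu ->
  stable_measure (fun S => mu S + e * nu S).
Proof.
move=> e0 [m0 ms] [n0 ns]; split=> S; first by rewrite addr_ge0 ?mulr_ge0.
by move=> sS; rewrite ms // ns // mulr0 addr0.
Qed.

Lemma coversD1 A W T : stable A -> covers (W :\: A) T -> covers W (T + 1).
Proof.
move=> sA [mu [sm mT mc]].
exists (fun S => mu S + 1 * (S == A)%:R); split.
- apply: stable_measureD sm _ => //; split=> S; first exact: ler0n.
  by case: eqP => // ->; rewrite sA.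
- rewrite massD mT mul1r; congr (_ + _).
  rewrite /mass (bigD1 A) //= eqxx big1 ?addr0 // => S /negbTE->//.
- move=> x xW; rewrite covD mul1r; case: (boolP (x \in A)) => xA.
    rewrite -[leLHS]add0r lerD //; first by apply: sumr_ge0 => S _; case: sm.
    by rewrite /cov (bigD1 A) //= eqxx lerDl sumr_ge0 // => S _; rewrite ler0n.
  rewrite -[leLHS]addr0 lerD //; first by apply: mc; rewrite inE xA.
  by apply: sumr_ge0 => S _; rewrite ler0n.
Qed.

Lemma covers0 : covers set0 0.
Proof.
exists (fun=> 0); split; first by split.
- by rewrite /mass big1.
- by move=> x; rewrite inE.
Qed.

(** Singletons serve as colours. This makes the infimum in [fchi] range over a nonempty set. *)
Lemma covers_card W : covers W #|W|%:R.
Proof.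
move: {2}#|W| (erefl #|W|) => n; elim: n W => [|n IH] W WE.
  by rewrite WE; move/eqP: WE; rewrite cards_eq0 => /eqP->; apply: covers0.
have /card_gt0P[x xW] : (0 < #|W|)%N by rewrite WE.
have Wx : #|W :\ x| = n by move: WE; rewrite (cardsD1 x) xW => -[].
by rewrite WE -natr1 -Wx; apply: (coversD1 (stable1 x)); apply: IH.
Qed.

Lemma covers_colourable T x : covers [set: G] T -> fractionally_colourable G T.
Proof.
move=> [mu [[m0 ms] mT mc]].
have T1 : 1 <= T.
  apply: le_trans (mc x (in_setT _)) _; rewrite -mT /mass (bigID (fun S => x \in S)) /=.
  by rewrite lerDl sumr_ge0.
have T0 : 0 < T by apply: lt_le_trans T1.
split=> //; exists (fun S => T^-1 * mu S); split.
  split=> [S|S sS|].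
  - by rewrite mulr_ge0 // invr_ge0 ltW.
  - by rewrite ms // mulr0.
  - by rewrite -mulr_sumr -/(mass mu) mT mulVf ?gt_eqF.
move=> y; rewrite -mulr_sumr -{1}[T^-1]mulr1 ler_wpM2l ?invr_ge0 ?(ltW T0) //.
by apply: mc; rewrite in_setT.
Qed.

(** * Greedy fractional colouring under a degree bound *)

Section Greedy.
Variables (a b D : R) (W : {set G}).
Hypothesis tf : triangle_free G.
Hypothesis occ : forall x : nat, (2 ^ x)%:R + 1 <= a + b / 2 * (x * 2 ^ x)%:R.
Hypotheses (a0 : 0 <= a) (b0 : 0 <= b) (D0 : 0 <= D).
Hypothesis degW : forall v, v \in W -> #|nbr v :&: W|%:R <= D.

(** The uniform measure on stable subsets of [U], left unnormalised because the greedy step length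
    rescales it. *)
Definition stable_ind U : {set G} -> R := fun S => (stable S && (S \subset U))%:R.

Lemma stable_ind_measure U : stable_measure (stable_ind U).
Proof.
by split=> S; rewrite /stable_ind ?ler0n // => /negbTE->.
Qed.

Lemma cov_stable_ind U v : v \in U -> 0 < cov (stable_ind U) v.
Proof.
move=> vU; rewrite /cov (bigD1 [set v]) ?inE //= ltr_pwDl //.
  by rewrite /stable_ind stable1 sub1set vU.
by apply: sumr_ge0 => S _; rewrite /stable_ind.
Qed.

Lemma cov_stable_ind_notin U v : v \notin U -> cov (stable_ind U) v = 0.
Proof.
move=> vU; rewrite /cov big1 // => S vS; rewrite /stable_ind.
case: (boolP (S \subset U)) => [/subsetP/(_ v vS)|_]; last by rewrite andbF.
by rewrite (negbTE vU).
Qed.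

Lemma mass_stable_ind U v : v \in U -> U \subset W ->
  mass (stable_ind U) <=
  a * cov (stable_ind U) v + b * \sum_(u in nbr v :&: W) cov (stable_ind U) u.
Proof.
move=> vU UW; have := occupancy occ tf vU; rewrite !big_mkcond /=.
rewrite (eq_bigr (stable_ind U)) => [|S _]; last by rewrite /stable_ind; case: ifP.
move/le_trans; apply; rewrite sum_cov covE !mulr_sumr -big_split big_mkcond /=.
apply: ler_sum => S _; rewrite /stable_ind; case: ifP => [/andP[_ SU]|_].
  have -> : S :&: (nbr v :&: W) = S :&: nbr v.
    by rewrite setIA; apply/setIidPl/(subset_trans (subsetIl _ _))/(subset_trans SU).
  by rewrite !mul1r.
by rewrite !mul0r !mulr0 addr0.
Qed.

(* Add uniform stable subsets of the set U of unsaturated vertices until some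
   vertex of U is covered exactly once. A vertex v which is still unsaturated
   has gained at least the added mass in the potential
   a * cov v + b * (cov of the neighbourhood of v), which is at most a + b * D. *)
Lemma greedy_saturation n U mu : (#|U| <= n)%N -> U \subset W -> stable_measure mu ->
  (forall v, v \in W -> cov mu v <= 1) ->
  (forall v, v \in W -> v \notin U -> cov mu v = 1) ->
  (forall v, v \in U -> mass mu <= a * cov mu v + b * \sum_(u in nbr v :&: W) cov mu u) ->
  mass mu <= a + b * D -> exists2 T, T <= a + b * D & covers W T.
Proof.
elim: n U mu => [|n IH] U mu Un UW sm c1 cU inv mD.
  move: Un; rewrite leqn0 cards_eq0 => /eqP U0.
  exists (mass mu) => //; exists mu; split=> // x xW.
  by rewrite cU // U0 inE.
have [U0|[v0 v0U]] := set_0Vmem U.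
  by apply: (IH U mu) => //; rewrite U0 cards0.
pose P := cov (stable_ind U).
(* [r v] is the multiple of [stable_ind U] that brings [v] to coverage exactly 1; the smallest one
   saturates its vertex and overshoots nowhere. *)
pose r v : R := (1 - cov mu v) / P v.
case: (Order.TotalTheory.arg_minP r v0U) => v vU0 rmin; have vU : v \in U := vU0; pose e := r v.
have Ppos u : u \in U -> 0 < P u by apply: cov_stable_ind.
have UWP u : u \in U -> u \in W by apply: (subsetP UW).
have e0 : 0 <= e by rewrite divr_ge0 ?subr_ge0 ?c1 ?UWP // ltW // Ppos.
pose mu' S := mu S + e * stable_ind U S.
have c'1 u : u \in W -> cov mu' u <= 1.
  move=> uW; rewrite covD; case: (boolP (u \in U)) => uU.
    by rewrite -lerBrDl -ler_pdivlMr ?Ppos // rmin.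
  by rewrite cov_stable_ind_notin // mulr0 addr0 c1.
have inv' u : u \in U ->
  mass mu' <= a * cov mu' u + b * \sum_(w in nbr u :&: W) cov mu' w.
  move=> uU; rewrite massD covD.
  under eq_bigr do rewrite covD.
  rewrite big_split /= -mulr_sumr.
  have := inv u uU; have := ler_wpM2l e0 (mass_stable_ind uU UW).
  by rewrite mulrDr !mulrDr ![b * (e * _)]mulrCA ![a * (e * _)]mulrCA; lra.
apply: (IH (U :\ v) mu').
- by move: Un; rewrite (cardsD1 v) vU.
- by apply: subset_trans UW; apply: subsetDl.
- exact: stable_measureD (stable_ind_measure U).
- by [].
- move=> u uW; rewrite in_setD1 negb_and negbK covD.
  have [-> _|_ /= uU] := eqVneq u v.
    by rewrite /e /r divfK ?gt_eqF ?Ppos //; ring.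
  by rewrite cov_stable_ind_notin // mulr0 addr0 cU.
- by move=> u /setD1P[_ uU]; apply: inv'.
(* At the moment [v] saturates its potential still dominates the mass, and coverages at most 1 bound
   that potential by [a + b * D]. *)
- apply: le_trans (inv' v vU) _; rewrite lerD //.
    by rewrite -[leRHS]mulr1 ler_wpM2l // c'1 // UWP.
  rewrite ler_wpM2l //; apply: le_trans (degW (UWP _ vU)).
  rewrite -sum1_card natr_sum; apply: ler_sum => w /setIP[_ wW].
  exact: c'1.
Qed.

Lemma covers_max_degree : exists2 T, T <= a + b * D & covers W T.
Proof.
have c0 v : cov (fun=> 0) v = 0 by rewrite /cov big1.
apply: (@greedy_saturation #|W| W (fun=> 0)) => //.
- by move=> v _; rewrite c0.
- by move=> v ->.
- move=> v _; rewrite /mass big1 // addr_ge0 ?mulr_ge0 ?c0 //.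
  by rewrite sumr_ge0 // => w _; rewrite c0.
- by rewrite /mass big1 // addr_ge0 ?mulr_ge0.
Qed.
End Greedy.

(** A neighbourhood with more than [D] vertices left in [W] is one colour, paid for by the drop of
    [#|W| / D] when it is removed. *)
Lemma covers_card_div (a b D : R) W : triangle_free G ->
  (forall x : nat, (2 ^ x)%:R + 1 <= a + b / 2 * (x * 2 ^ x)%:R) ->
  0 <= a -> 0 <= b -> 0 < D ->
  exists2 T, T <= #|W|%:R / D + (a + b * D) & covers W T.
Proof.
move=> tf occ a0 b0 D0.
have [n] := ubnP #|W|; elim: n W => // n IH W Wn.
case: (pickP (fun v => D < #|nbr v :&: W|%:R)) => [v vD | small]; last first.
  have [|T TD cT] := @covers_max_degree a b D W tf occ a0 b0 (ltW D0).
    by move=> v _; rewrite leNgt small.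
  by exists T => //; apply: le_trans TD _; rewrite lerDr divr_ge0 // ltW.
have cW := cardsID (nbr v) W; rewrite setIC in cW.
have N0 : (0 < #|nbr v :&: W|)%N by rewrite -(ltr_nat R) (lt_trans D0).
have [|T TD cT] := IH (W :\: nbr v).
  move: Wn; rewrite -cW; case: #|nbr v :&: W| N0 => // k _; rewrite ltnS addSn.
  by apply: leq_ltn_trans; rewrite leq_addl.
exists (T + 1); last exact: coversD1 (stable_nbr v tf) cT.
apply: le_trans (lerD TD (lexx 1)) _.
rewrite -cW natrD mulrDl; have : 1 <= #|nbr v :&: W|%:R / D by rewrite ler_pdivlMr // mul1r ltW.
lra.
Qed.
End Covers.

(** * Bounds passing to the infimum *)

Section Fchi.
Variable R : realType.

Lemma fchi_le (k : R) : fractionally_colourable G k -> fchi G R <= k.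
Proof. by move=> kc; apply: ge_inf => //; exists 0 => x [/ltW]. Qed.

Lemma le_fchi (c : R) x :
  (forall k, fractionally_colourable G k -> c <= k) -> c <= fchi G R.
Proof.
move=> H; apply: lb_le_inf => //.
exists #|[set: G]|%:R; apply: (covers_colourable x); exact: covers_card.
Qed.

(** For [b > 0] divide by [b]; for [b = 0] a single colourable [k] already gives [a <= 0]. *)
Lemma le_mul_fchi (a b : R) x : 0 <= b ->
  (forall k, fractionally_colourable G k -> a <= b * k) -> a <= b * fchi G R.
Proof.
move=> b0 ab; have [b00|bn0] := eqVneq b 0.
  have := ab _ (covers_colourable x (covers_card R _)).
  by rewrite b00 !mul0r.
have bp : 0 < b by rewrite lt_def bn0.
rewrite mulrC -ler_pdivrMr //; apply: (le_fchi x) => k kc.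
by rewrite ler_pdivrMr // mulrC ab.
Qed.
End Fchi.
End Nbr.

(** * Choice of parameters and the bound in the number of vertices *)

(** For [x <= L] the constant term suffices; for [x > L] the other term is [2 * (x / L) * 2 ^ x], at
    least [2 * 2 ^ x]. *)
Lemma occupancy_parameters (R : realType) (L : nat) : (0 < L)%N ->
  forall x : nat,
    (2 ^ x)%:R + 1 <= (2 ^ L)%:R + 1 + 4 / L%:R / 2 * (x * 2 ^ x)%:R :> R.
Proof.
move=> L0 x; have L0' : 0 < L%:R :> R by rewrite ltr0n.
have [xL|Lx] := leqP x L.
  have : (2 ^ x)%:R <= (2 ^ L)%:R :> R by rewrite ler_nat leq_exp2l.
  have : 0 <= 4 / L%:R / 2 * (x * 2 ^ x)%:R :> R.
    by rewrite mulr_ge0 ?divr_ge0 ?ler0n.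
  lra.
have : 1 <= x%:R / L%:R :> R by rewrite ler_pdivlMr // mul1r ler_nat ltnW.
rewrite natrM [_ * (_ * _)](_ : _ = 2 * (x%:R / L%:R * (2 ^ x)%:R)); last by field; lra.
have x1 : 1 <= (2 ^ x)%:R :> R by rewrite ler1n expn_gt0.
have L1 : 0 <= (2 ^ L)%:R :> R by rewrite ler0n.
by move=> q; have : (2 ^ x)%:R <= x%:R / L%:R * (2 ^ x)%:R :> R; [rewrite ler_peMl | lra].
Qed.

(** Base 16 makes [4 ^ L] of order the square root of [n]. With [l = L - 1], this leaves a spare
    factor [4 ^ l] to absorb the logarithm through [l + 1 <= 4 ^ l]. *)
Lemma pow2_trunc_log16 (R : realType) (n : nat) (s : R) : (2 <= n)%N -> 0 <= s ->
    s ^+ 2 * ln n%:R = n%:R ->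
  let L := (trunc_log 16 n).+1 in
  ln n%:R <= 16 * L%:R :> R /\ (2 ^ L)%:R <= 8 * s.
Proof.
move=> n2 s0 sE L; have n0 : (0 < n)%N by apply: ltnW.
have /andP[nlo nhi] := trunc_log_bounds (isT : 1 < 16)%N n0.
have ln16 : ln 16 <= 16 :> R by apply/ltW/ln_sublinear; lra.
have lnL : ln n%:R <= 16 * L%:R :> R.
  apply: (@le_trans _ _ (ln (16 ^+ L))).
    by rewrite ler_ln ?posrE ?exprn_gt0 ?ltr0n // -natrX ler_nat ltnW.
  by rewrite lnXn // -[leLHS]mulr_natr ler_wpM2r ?ler0n.
split=> //.
have ln0 : 0 < ln n%:R :> R by rewrite ln_gt0 // ltr1n.
have s0' : 0 <= 8 * s by lra.
rewrite -(@ler_sqr R) ?nnegrE ?ler0n // exprMn -(ler_pM2r ln0) -[leRHS]mulrA sE.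
apply: (@le_trans _ _ ((2 ^ L)%:R ^+ 2 * (16 * L%:R))).
  by rewrite ler_wpM2l // sqr_ge0.
rewrite -natrX -!natrM; have -> : 8 ^+ 2 = 64%:R :> R by rewrite -natrX.
rewrite -natrM ler_nat /L; set l := trunc_log 16 n in nlo nhi *.
apply: leq_trans (leq_mul (leqnn 64) nlo).
have -> : (16 ^ l = 4 ^ l * 4 ^ l)%N by rewrite -expnMn.
have -> : ((2 ^ l.+1) ^ 2 = 4 * 4 ^ l)%N by rewrite -expnM mulnC expnM expnS.
have : (l.+1 <= 4 ^ l)%N by apply: ltn_expl.
have -> : (4 * 4 ^ l * (16 * l.+1) = 64 * (4 ^ l * l.+1))%N by ring.
by move=> lq; rewrite !leq_mul2l lq orbT.
Qed.

(** Take [D = s * ln n]. Then [n / D = s], [a = 2 ^ L + 1 <= 16 * s] and [b * D <= 64 * s], which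
    add up to [81 * s]. *)
Lemma fchi_triangle_free_le (R : realType) (G : sgraph) :
  triangle_free G -> (2 <= #|G|)%N ->
  fchi G R <= 81 * Num.sqrt (#|G|%:R / ln #|G|%:R).
Proof.
move=> tf n2; set n := #|G| in n2 *; set s := Num.sqrt _.
have ln0 : 0 < ln n%:R :> R by rewrite ln_gt0 // ltr1n.
have n0 : 0 < n%:R :> R by rewrite ltr0n ltnW.
have s0 : 0 < s by rewrite sqrtr_gt0 divr_gt0.
have sE : s ^+ 2 * ln n%:R = n%:R.
  by rewrite sqr_sqrtr ?divr_ge0 ?(ltW n0) ?(ltW ln0) // divfK // gt_eqF.
have [lnL powL] := pow2_trunc_log16 n2 (ltW s0) sE.
set L := (trunc_log 16 n).+1 in lnL powL.
have L0 : 0 < L%:R :> R by rewrite ltr0n.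
have D0 : 0 < s * ln n%:R by rewrite mulr_gt0.
have occ := occupancy_parameters R (ltn0Sn _ : 0 < L)%N.
have [||T TD cT] := covers_card_div [set: G] tf occ _ _ D0.
- by rewrite addr_ge0 ?ler0n.
- by rewrite divr_ge0 ?ler0n.
have /card_gt0P[x _] : (0 < #|[set: G]|)%N by rewrite cardsT -/n ltnW.
apply: le_trans (fchi_le (covers_colourable x cT)) _; apply: le_trans TD _.
rewrite cardsT -/n -{1}sE.
have -> : s ^+ 2 * ln n%:R / (s * ln n%:R) = s by field; rewrite !gt_eqF.
have pow1 : 1 <= (2 ^ L)%:R :> R by rewrite ler1n expn_gt0.
have : 4 / L%:R * (s * ln n%:R) <= 64 * s.
  rewrite mulrAC ler_pdivrMr //.
  by have := ler_wpM2l (ltW s0) lnL; lra.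
by lra.
Qed.

(** * Neighbourhoods of stable sets of the cube *)

Section Cube.
Variable G : sgraph.
Implicit Types (x y u v : G) (S : {set G}).

Lemma path_cube_adj x y (k : 'I_4) (p : k.-tuple G) :
  x != y -> path (@adj G) x p -> last x p = y -> uniq (x :: p) -> cube_adj x y.
Proof.
move=> nxy xp py up; rewrite /cube_adj nxy; apply/existsP; exists k.
by apply/existsP; exists p; rewrite xp py eqxx up.
Qed.

Lemma adj_neq x y : adj x y -> x != y.
Proof. by apply: contraTneq => ->; rewrite adj_irrefl. Qed.

Lemma walk2_cube_adj x u y : x != y -> adj x u -> adj u y -> cube_adj x y.
Proof.
move=> nxy xu uy.
apply: (@path_cube_adj x y (Ordinal (isT : 2 < 4)%N) [tuple u; y]) => //=.
  by rewrite xu uy.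
by rewrite !inE negb_or (adj_neq xu) nxy (adj_neq uy).
Qed.

(** If the walk repeats a vertex, its first or last edge already joins [x] and [y]; otherwise it is
    a path. *)
Lemma walk3_cube_adj x u v y :
  x != y -> adj x u -> adj u v -> adj v y -> cube_adj x y.
Proof.
move=> nxy xu uv vy.
have [xv|nxv] := eqVneq x v.
  apply: (@path_cube_adj x y (Ordinal (isT : 1 < 4)%N) [tuple y]) => //=.
    by rewrite xv vy.
  by rewrite !inE nxy.
have [uy|nuy] := eqVneq u y.
  apply: (@path_cube_adj x y (Ordinal (isT : 1 < 4)%N) [tuple y]) => //=.
    by rewrite -uy xu.
  by rewrite !inE nxy.
apply: (@path_cube_adj x y (Ordinal (isT : 3 < 4)%N) [tuple u; v; y]) => //=.
  by rewrite xu uv vy.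
by rewrite !inE !negb_or (adj_neq xu) nxv nxy (adj_neq uv) nuy (adj_neq vy).
Qed.

Definition nbrs S : {set G} := [set u | [exists x in S, adj x u]].

Lemma nbrsP S u : reflect (exists2 x, x \in S & adj x u) (u \in nbrs S).
Proof.
by rewrite inE; apply: (iffP existsP) => [[x /andP[]]|[x xS xu]];
  exists x => //; apply/andP.
Qed.

(** An edge inside [nbrs S] closes a triangle if its ends share a neighbour in [S], and otherwise
    gives a three-edge walk between distinct members of [S]. *)
Lemma stable_nbrs S : triangle_free G -> @stable (cube G) S -> stable (nbrs S).
Proof.
move=> tf /(@stableP (cube G)) sS.
apply/stableP=> u v /nbrsP[x xS xu] /nbrsP[y yS yv]; apply/negP=> uv.
have [xy|nxy] := eqVneq x y.
  by have := tf x u v; rewrite xu uv xy yv.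
by have /negP := sS x y xS yS; apply; apply: (walk3_cube_adj nxy xu uv); rewrite adj_sym.
Qed.

Section Real.
Variable R : realType.
Implicit Types (mu : {set G} -> R) (k : R).

(** At most one term is nonzero: two neighbours of [u] in [S] would be adjacent in the cube. *)
Lemma nbrs_ind S u : @stable (cube G) S ->
  (u \in nbrs S)%:R = \sum_(x | adj x u) (x \in S)%:R :> R.
Proof.
move=> sS; case: nbrsP => [[x xS xu]|no].
  rewrite (bigD1 x) //= xS big1 ?addr0 // => y /andP[yu nyx].
  apply/eqP; rewrite (_ : _ \in _ = false) //; apply/negP=> yS.
  have /negP := stableP (G := cube G) _ sS y x yS xS; apply.
  by apply: (walk2_cube_adj nyx yu); rewrite adj_sym.
by rewrite big1 // => x xu; case: (boolP (x \in S)) => // xS; case: no; exists x.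
Qed.

Lemma sum_nbrs_ind mu u : (forall S, ~~ @stable (cube G) S -> mu S = 0) ->
  \sum_(S : {set G}) mu S * (u \in nbrs S)%:R = \sum_(x | adj x u) cov mu x.
Proof.
move=> ms; under [RHS]eq_bigr do rewrite covE.
rewrite exchange_big; apply: eq_bigr => S _; rewrite -mulr_sumr.
by case: (boolP (@stable (cube G) S)) => [/nbrs_ind->|/ms->]; rewrite ?mul0r.
Qed.

(** Push [mu] forward along [nbrs]. Each of the at least [d] neighbours of [u] adds at least [k^-1]
    to its coverage, without overlap. *)
Lemma colourable_nbrs (k d : R) : triangle_free G -> 0 < d -> min_degree_ge G d ->
  fractionally_colourable (cube G) k -> fractionally_colourable G (k / d).
Proof.
move=> tf d0 degd [k0 [mu [[m0 ms mT] mc]]].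
split; first by rewrite divr_gt0.
exists (fun A => \sum_(S : {set G} | nbrs S == A) mu S); split.
  split=> [A|A sA|].
  - exact: sumr_ge0.
  - rewrite big1 // => S /eqP SA; apply: ms; apply: contra sA.
    by rewrite -SA; apply: stable_nbrs.
  - by rewrite -mT [RHS](partition_big nbrs xpredT).
move=> u; apply: (@le_trans _ _ (\sum_(x | adj x u) cov mu x)); last first.
  rewrite -sum_nbrs_ind // [leLHS](partition_big nbrs xpredT) //=.
  rewrite [leRHS]big_mkcond; apply: ler_sum => A _ /=; case: ifP => uA.
    by apply: ler_sum => S _; rewrite ler_piMr // lern1 leq_b1.
  by rewrite big1 // => S /eqP->; rewrite uA mulr0.
apply: (@le_trans _ _ (\sum_(x | adj x u) k^-1)); last first.
  by apply: ler_sum => x _; apply: mc.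
rewrite sumr_const invf_div -[_ *+ _]mulr_natl ler_wpM2r ?invr_ge0 ?(ltW k0) //.
apply: le_trans (degd u) _; rewrite ler_nat /degree; apply: subset_leq_card.
by apply/subsetP=> x; rewrite inE adj_sym.
Qed.

Lemma fchi_le_cube_div (d : R) (x : G) : triangle_free G -> 0 < d ->
  min_degree_ge G d -> fchi G R <= fchi (cube G) R / d.
Proof.
move=> tf d0 degd; rewrite ler_pdivlMr //; apply: (@le_fchi (cube G) _ _ x) => k kc.
by rewrite -ler_pdivlMr //; apply: fchi_le; apply: colourable_nbrs kc.
Qed.
End Real.
End Cube.

(* Keep each vertex x of the random stable set independently with probability
   1 / (k * cov mu x). *)
Lemma exact_distribution (R : realType) (G : sgraph) (k : R) :
  fractionally_colourable G k ->
  exists mu : {set G} -> R, stable_distribution mu /\ forall x, cov mu x = k^-1.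
Proof.
move=> [k0 [mu [[m0 ms mT] mc]]].
have c0 x : 0 < cov mu x by apply: lt_le_trans (mc x); rewrite invr_gt0.
pose t (S : {set G}) x : R := (x \in S)%:R * (k * cov mu x)^-1.
have t0 S x : 0 <= t S x.
  by rewrite mulr_ge0 ?ler0n // invr_ge0 mulr_ge0 // ltW.
have t1 S x : t S x <= 1.
  rewrite /t; case: (x \in S); rewrite ?mul0r // mul1r invf_le1 ?mulr_gt0 //.
  by rewrite -ler_pdivrMl // mulr1; apply: mc.
(* [q S A] is the probability that thinning [S] leaves [A]; it vanishes unless [A \subset S]. *)
pose q (S A : {set G}) : R := \prod_x (if x \in A then t S x else 1 - t S x).
exists (fun A => \sum_(S : {set G}) mu S * q S A); split.
  split=> [A|A nA|].
  - apply: sumr_ge0 => S _; rewrite mulr_ge0 // prodr_ge0 // => x _.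
    by case: ifP; rewrite ?subr_ge0.
  - rewrite big1 // => S _; case: (boolP (stable S)) => [sS|/ms->]; last by rewrite mul0r.
    have /subsetPn[x xA xS] : ~~ (A \subset S).
      by apply: contra nA => AS; apply: stable_sub sS.
    by rewrite /q (bigD1 x) //= xA /t (negbTE xS) !mul0r mulr0.
  - rewrite exchange_big /= -mT; apply: eq_bigr => S _.
    rewrite -mulr_sumr /q -bigA_distr big1 ?mulr1 // => x _.
    by rewrite /= addrC subrK.
move=> y; rewrite covE.
under eq_bigr do rewrite mulr_suml.
rewrite exchange_big /=.
have marg S : \sum_(A : {set G}) mu S * q S A * (y \in A)%:R = mu S * t S y.
  under eq_bigr do rewrite -mulrA.
  rewrite -mulr_sumr; congr (_ * _).
  (* Setting [H y] to 0 kills the terms with [y \notin A] when the product of [F x + H x] is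
     expanded. *)
  pose F x := t S x; pose H x : R := if x == y then 0 else 1 - t S x.
  transitivity (\prod_x (F x + H x)).
    rewrite bigA_distr; apply: eq_bigr => A _.
    case: (boolP (y \in A)) => yA.
      rewrite mulr1; apply: eq_bigr => x _; case: ifP => // xA; rewrite /H.
      by case: eqP xA => // ->; rewrite yA.
    by rewrite mulr0 (bigD1 y) //= (negbTE yA) /H eqxx mul0r.
  rewrite (bigD1 y) //= /H eqxx addr0 big1 ?mulr1 // => x /negbTE->.
  by rewrite /F addrC subrK.
under eq_bigr do rewrite marg /t mulrA.
rewrite -mulr_suml -covE invfM mulrCA divff ?mulr1 // gt_eqF //.
Qed.

(** * Bipartite induced subgraphs and edges between stable sets *)

Section Bipartite.
Variable G : sgraph.
Implicit Types (x y u v : G) (A B S : {set G}).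

(** [A] and [B] may overlap: the union still splits into [A] and a remainder inside [B]. *)
Definition bip_deg A B (M : nat) : bool :=
  [&& stable A, stable B, (0 < #|A :|: B|)%N &
      [forall x in A :|: B, (M <= #|nbr x :&: (A :|: B)|)%N]].

Lemma bip_deg_induced (R : realType) (c : R) A B M : bip_deg A B M -> c <= M%:R ->
  has_bipartite_induced_subgraph G c.
Proof.
case/and4P=> sA sB W0 /forallP degM cM; exists (A :|: B); split=> //.
  exists [set u : induced (A :|: B) | val u \in A]; split; apply/stableP=> u v.
    by rewrite !inE; apply: (stableP A sA).
  rewrite !inE => uA vA; apply: (stableP B sB).
    by have := valP u; rewrite in_setU (negbTE uA).
  by have := valP v; rewrite in_setU (negbTE vA).
move=> x; apply: le_trans cM _; rewrite ler_nat.
apply: leq_trans (implyP (degM (val x)) (valP x)) _; rewrite /degree.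
rewrite -(card_imset _ val_inj); apply: subset_leq_card; apply/subsetP=> y.
rewrite in_setI in_nbr => /andP[xy yW]; apply/imsetP.
by exists (Sub y yW : induced (A :|: B)); rewrite ?inE ?SubK.
Qed.

Definition cross A B : nat := \sum_(x in A) \sum_(y in B) adj x y.

Lemma crossC A B : cross A B = cross B A.
Proof.
rewrite /cross exchange_big; apply: eq_bigr => y _; apply: eq_bigr => x _.
by rewrite adj_sym.
Qed.

Lemma cross_leD1 A B x M : x \in A -> (#|nbr x :&: B| <= M)%N ->
  (cross A B <= M + cross (A :\ x) B)%N.
Proof.
move=> xA xM; rewrite /cross (big_setD1 x) //= leq_add2r.
apply: leq_trans xM; rewrite -sum1_card.
rewrite [leqRHS](eq_bigl (fun y => (y \in B) && adj x y)) => [|y].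
  by rewrite big_mkcondr; apply: leq_sum => y _; case: (adj x y).
by rewrite in_setI in_nbr andbC.
Qed.

(** Degeneracy: some vertex has at most [M] neighbours in [A :|: B]. Deleting it from one of the
    sets loses at most [M] pairs and lowers [#|A| + #|B|] by one. *)
Lemma cross_le M A B : (forall A' B', ~~ bip_deg A' B' M.+1) ->
  stable A -> stable B -> (cross A B <= M * (#|A| + #|B|))%N.
Proof.
move=> noM; have [n] := ubnP (#|A| + #|B|); elim: n A B => // n IH A B ABn sA sB.
have [AB0|W0] := eqVneq (A :|: B) set0.
  rewrite /cross big1 // => x xA; have := in_set0 x.
  by rewrite -AB0 in_setU xA.
have : ~~ [forall x in A :|: B, (M < #|nbr x :&: (A :|: B)|)%N].
  by have := noM A B; rewrite /bip_deg sA sB card_gt0 W0.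
case/forallPn=> x; rewrite negb_imply -leqNgt => /andP[xW xM].
have [xA|nxA] := boolP (x \in A).
  have xBM : (#|nbr x :&: B| <= M)%N.
    by apply: leq_trans xM; rewrite subset_leq_card // setIS // subsetUr.
  apply: leq_trans (cross_leD1 xA xBM) _.
  rewrite (cardsD1 x A) xA addSn mulnS leq_add2l; apply: IH => //.
    by move: ABn; rewrite (cardsD1 x A) xA.
  by apply: stable_sub sA; apply: subsetDl.
have xB : x \in B by move: xW; rewrite in_setU (negbTE nxA).
have xAM : (#|nbr x :&: A| <= M)%N.
  by apply: leq_trans xM; rewrite subset_leq_card // setIS // subsetUl.
rewrite crossC addnC; apply: leq_trans (cross_leD1 xB xAM) _.
rewrite (cardsD1 x B) xB addSn mulnS leq_add2l crossC addnC; apply: IH => //.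
  by move: ABn; rewrite (cardsD1 x B) xB addnCA add1n.
by apply: stable_sub sB; apply: subsetDl.
Qed.

(** A single vertex achieves 0 and no value exceeds [#|G|]. The maximum supplies both the final
    subgraph and the hypothesis of [cross_le]. *)
Lemma max_bip_deg x : exists M : nat,
  (exists A B, bip_deg A B M) /\ forall A B, ~~ bip_deg A B M.+1.
Proof.
pose P M := [exists A, exists B, bip_deg A B M].
have P0 : exists M, P M.
  exists 0%N; apply/existsP; exists [set x]; apply/existsP; exists [set x].
  rewrite /bip_deg stable1 setUid cards1 /=.
  by apply/forallP=> y; apply/implyP.
have Pmax M : P M -> (M <= #|G|)%N.
  case/existsP=> A /existsP[B /and4P[_ _ /card_gt0P[y yW] /forallP/(_ y)]].
  by rewrite yW => /leq_trans -> //; rewrite max_card.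
case: (ex_maxnP P0 Pmax) => M /existsP[A /existsP[B AB]] maxM.
exists M; split=> [|A' B']; first by exists A, B.
apply/negP=> AB'; suff /maxM : P M.+1 by rewrite ltnn.
by apply/existsP; exists A'; apply/existsP; exists B'.
Qed.

(** * Counting edges and walks by degrees *)

Lemma sum_degree_le : (\sum_(u : G) degree u <= 2 * #|edges G|)%N.
Proof.
have -> : (\sum_(u : G) degree u = #|[set p : G * G | adj p.1 p.2]|)%N.
  rewrite /degree -sum1_card.
  under eq_bigr do rewrite -sum1_card.
  by rewrite pair_big_dep; apply: eq_bigl => p /=; rewrite !inE.
pose f (p : G * G) := [set p.1; p.2].
rewrite -sum1_card (partition_big f (fun e => e \in edges G)) /=; last first.
  by move=> p; rewrite inE => pp; apply/imsetP; exists p; rewrite ?inE.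
rewrite mulnC -sum_nat_const; apply: leq_sum => e /imsetP[[a b] _ ->] /=.
rewrite sum1dep_card; apply: (@leq_trans #|[set (a, b); (b, a)]|).
  apply: subset_leq_card; apply/subsetP=> -[c d]; rewrite !inE /= => /andP[cd /eqP/setP cdE].
  have ncd := adj_neq cd.
  have : c \in [set a; b] by rewrite -cdE !inE eqxx.
  have : d \in [set a; b] by rewrite -cdE !inE eqxx orbT.
  by move: ncd => /[swap] /set2P[] -> /[swap] /set2P[] ->; rewrite !xpair_eqE !eqxx ?orbT.
by rewrite cards2; case: (_ != _).
Qed.

(** A walk is determined by its middle edge and a neighbour of each end of that edge. *)
Lemma card_walks3_le :
  (#|walks3 G| <= \sum_(u : G) \sum_(v : G) adj u v * (degree u * degree v))%N.
Proof.
pose f (w : 4.-tuple G) :=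
  ((tnth w (inord 1), tnth w (inord 2)), (tnth w (inord 0), tnth w (inord 3))).
pose Q := [set p : (G * G) * (G * G) | adj p.1.1 p.1.2 &&
   ((p.2.1 \in nbr p.1.1) && (p.2.2 \in nbr p.1.2))].
have -> : (\sum_(u : G) \sum_(v : G) adj u v * (degree u * degree v) = #|Q|)%N.
  rewrite pair_big /= -sum1_card.
  rewrite (eq_bigl (fun p : (G * G) * (G * G) => adj p.1.1 p.1.2 &&
    ((p.2.1 \in nbr p.1.1) && (p.2.2 \in nbr p.1.2)))) => [|p]; last by rewrite inE.
  rewrite -(pair_big_dep (fun q : G * G => adj q.1 q.2)
     (fun q r : G * G => (r.1 \in nbr q.1) && (r.2 \in nbr q.2)) (fun _ _ => 1%N)) /=.
  rewrite [RHS]big_mkcond; apply: eq_bigr => -[u v] _ /=.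
  case: (adj u v); rewrite ?mul0n // mul1n.
  rewrite -(pair_big (mem (nbr u)) (mem (nbr v)) (fun _ _ => 1%N)) /=.
  by under eq_bigr do rewrite sum1_card; rewrite sum_nat_const.
rewrite -(@card_in_imset _ _ f); last first.
  move=> [[|w0 [|w1 [|w2 [|w3 [|]]]]] i] // [[|z0 [|z1 [|z2 [|z3 [|]]]]] j] // _ _.
  rewrite /f !(tnth_nth w0) /= !inordK //= => -[-> -> -> ->].
  exact: val_inj.
apply: subset_leq_card; apply/subsetP=> p /imsetP[w].
case: w => [[|w0 [|w1 [|w2 [|w3 [|]]]]] i] //; rewrite inE /= andbT => /and3P[a01 a12 a23].
move=> ->; rewrite inE /f !(tnth_nth w0) /= !inordK //= a12 !inE a23 andbT /=.
by rewrite adj_sym.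
Qed.

(** * Comparing expectations for two independent stable sets of the cube *)

Section Expectation.
Variables (R : realType) (k : R) (M : nat).
Hypothesis tf : triangle_free G.
Hypothesis kc : fractionally_colourable (cube G) k.
Hypothesis noM : forall A B, ~~ bip_deg A B M.+1.

(* For independent random stable sets S and T of the cube containing each vertex
   with probability exactly 1/k, compare the expectations of the two sides of
   cross_le for the neighbourhoods of S and T. *)
Lemma degree_product_le :
  \sum_(u : G) \sum_(v : G) (adj u v)%:R * ((degree u)%:R * (degree v)%:R)
    <= M%:R * (2 * \sum_(u : G) (degree u)%:R) * k.
Proof.
(* Exact coverage evaluates both sides; a lower bound on coverage would control only the left
   one. *)
have [k0 _] := kc; have [mu [[m0 ms mT] mc]] := exact_distribution kc.
have mcG (x : G) : @cov G R mu x = k^-1 := mc x.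
have mTG : \sum_(S : {set G}) mu S = 1 := mT.
pose f (S : {set G}) u : R := (u \in nbrs S)%:R.
have Ef u : \sum_(S : {set G}) mu S * f S u = (degree u)%:R / k.
  rewrite sum_nbrs_ind //; under eq_bigr do rewrite mcG.
  rewrite sumr_const -[_ *+ _]mulr_natl; congr (_%:R * _).
  by rewrite /degree; apply: eq_card => x; rewrite !inE [LHS]adj_sym.
have ST (S T : {set G}) :
    mu S * mu T * (\sum_(u : G) \sum_(v : G) (adj u v)%:R * (f S u * f T v)) <=
    mu S * mu T * (M%:R * (\sum_(u : G) f S u + \sum_(v : G) f T v)).
  case: (boolP (@stable (cube G) S)) => [sS|/ms->]; last by rewrite !mul0r.
  case: (boolP (@stable (cube G) T)) => [sT|/ms->]; last by rewrite mulr0 !mul0r.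
  rewrite ler_wpM2l ?mulr_ge0 //.
  have sumf (S' : {set G}) : \sum_(u : G) f S' u = #|nbrs S'|%:R.
    rewrite -sum1_card natr_sum [RHS]big_mkcond; apply: eq_bigr => u _.
    by rewrite /f; case: (_ \in _).
  rewrite !sumf -natrD -natrM; apply: le_trans (_ : (cross (nbrs S) (nbrs T))%:R <= _).
    rewrite /cross natr_sum [leRHS]big_mkcond; apply: ler_sum => u _; rewrite /f.
    case: (u \in nbrs S); last by rewrite big1 // => v _; rewrite mul0r mulr0.
    rewrite natr_sum [leRHS]big_mkcond; apply: ler_sum => v _; rewrite mul1r.
    by case: (v \in nbrs T); rewrite ?mulr1 ?mulr0.
  by rewrite ler_nat cross_le ?stable_nbrs.
have LE : \sum_(S : {set G}) \sum_(T : {set G})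
      mu S * mu T * (\sum_(u : G) \sum_(v : G) (adj u v)%:R * (f S u * f T v)) <=
    \sum_(S : {set G}) \sum_(T : {set G})
      mu S * mu T * (M%:R * (\sum_(u : G) f S u + \sum_(v : G) f T v)).
  by apply: ler_sum => S _; apply: ler_sum.
have ER : \sum_(S : {set G}) mu S * (\sum_(u : G) f S u) = (\sum_(u : G) (degree u)%:R) / k.
  under eq_bigr do rewrite mulr_sumr.
  by rewrite exchange_big mulr_suml; apply: eq_bigr.
have RE : \sum_(S : {set G}) \sum_(T : {set G})
      mu S * mu T * (M%:R * (\sum_(u : G) f S u + \sum_(v : G) f T v)) =
      M%:R * (2 * \sum_(u : G) (degree u)%:R) / k.
  transitivity (\sum_(S : {set G}) M%:R * (mu S * (\sum_(u : G) f S u) +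
      mu S * ((\sum_(u : G) (degree u)%:R) / k))).
    apply: eq_bigr => S _; rewrite -ER.
    transitivity (M%:R * (mu S * (\sum_(u : G) f S u)) * (\sum_(T : {set G}) mu T) +
       M%:R * mu S * (\sum_(T : {set G}) mu T * (\sum_(u : G) f T u))).
      rewrite [X in X + _]mulr_sumr [X in _ + X]mulr_sumr -big_split.
      by apply: eq_bigr => T _ /=; ring.
    by rewrite mTG; ring.
  by rewrite -mulr_sumr big_split /= ER -mulr_suml mTG; ring.
have LEq : \sum_(S : {set G}) \sum_(T : {set G})
      mu S * mu T * (\sum_(u : G) \sum_(v : G) (adj u v)%:R * (f S u * f T v)) =
      (\sum_(u : G) \sum_(v : G) (adj u v)%:R * ((degree u)%:R * (degree v)%:R)) / k / k.
  transitivity (\sum_(S : {set G}) \sum_(T : {set G}) \sum_(u : G) \sum_(v : G)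
      (adj u v)%:R * ((mu S * f S u) * (mu T * f T v))).
    apply: eq_bigr => S _; apply: eq_bigr => T _.
    rewrite mulr_sumr; apply: eq_bigr => u _; rewrite mulr_sumr; apply: eq_bigr => v _.
    ring.
  under eq_bigr do rewrite exchange_big.
  rewrite exchange_big !mulr_suml; apply: eq_bigr => u _ /=.
  under eq_bigr do rewrite exchange_big.
  rewrite exchange_big !mulr_suml; apply: eq_bigr => v _ /=.
  transitivity ((adj u v)%:R * ((\sum_(S : {set G}) mu S * f S u) *
                                (\sum_(T : {set G}) mu T * f T v))).
    rewrite mulr_suml mulr_sumr; apply: eq_bigr => S _.
    by rewrite mulr_sumr mulr_sumr.
  by rewrite !Ef; field; rewrite gt_eqF.
(* The left side is quadratic in [k^-1] and the right side linear, so one factor cancels. *)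
move: LE; rewrite LEq RE ler_pM2r ?invr_gt0 // ler_pdivrMr //.
Qed.
End Expectation.
End Bipartite.

(** * Assembly of the bounds *)

Theorem theorem5p1 (R : realType) :
  (exists C1 : R, 0 < C1 /\
     forall (G : sgraph) (d : R),
       0 < d -> d <= #|G|%:R / 2 ->
       triangle_free G -> min_degree_ge G d ->
       fchi G R <= Num.min (C1 * Num.sqrt (#|G|%:R / ln #|G|%:R))
                           (fchi (cube G) R / d))
  /\
  (forall G : sgraph,
     triangle_free G -> (2 <= #|G|)%N -> (1 <= #|edges G|)%N ->
     has_bipartite_induced_subgraph G
       (#|walks3 G|%:R / (4 * fchi (cube G) R * #|edges G|%:R))
     /\
     forall d : R, 0 <= d -> min_degree_ge G d ->
       has_bipartite_induced_subgraph G (d ^+ 2 / (2 * fchi (cube G) R))).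
Proof.
split.
  exists 81; split=> // G d d0 dn tf degd.
  have /card_gt0P[x _] : (0 < #|G|)%N.
    by rewrite -(ltr_nat R); have := lt_le_trans d0 dn; lra.
  have /card_gt0P[y] : (0 < degree x)%N by rewrite -(ltr_nat R) (lt_le_trans d0).
  rewrite inE => /adj_neq xy.
  have n2 : (2 <= #|G|)%N by have := max_card [set x; y]; rewrite cards2 xy.
  by rewrite le_min fchi_le_cube_div // fchi_triangle_free_le.
move=> G tf n2 m1.
have /card_gt0P[x _] : (0 < #|G|)%N by apply: ltnW.
have [M [[A [B AB]] noM]] := max_bip_deg x.
set chi := fchi (cube G) R.
have chi0 : 0 <= chi by apply: (@le_fchi (cube G) _ _ x) => k [/ltW].
have m0 : 0 < #|edges G|%:R :> R by rewrite ltr0n.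
have degm : \sum_(u : G) (degree u)%:R <= 2 * #|edges G|%:R :> R.
  by rewrite -natr_sum -natrM ler_nat sum_degree_le.
set X := \sum_(u : G) \sum_(v : G) (adj u v)%:R * ((degree u)%:R * (degree v)%:R) : R.
have Xchi : X <= M%:R * (2 * \sum_(u : G) (degree u)%:R) * chi.
  apply: (le_mul_fchi (G := cube G) x) => [|k kc]; last exact: degree_product_le.
  by rewrite !mulr_ge0 ?sumr_ge0 ?ler0n.
split=> [|d d0 degd]; apply: bip_deg_induced AB _.
  (* The inverse of 0 is 0, so in this case the claimed degree is 0. *)
  have [->|chin0] := eqVneq chi 0; first by rewrite mulr0 mul0r invr0 mulr0.
  have chip : 0 < chi by rewrite lt_def chin0.
  rewrite ler_pdivrMr; last by rewrite !mulr_gt0.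
  have w3X : #|walks3 G|%:R <= X.
    apply: le_trans (_ : _ <= (\sum_(u : G) \sum_(v : G) adj u v * (degree u * degree v))%N%:R) _.
      by rewrite ler_nat card_walks3_le.
    rewrite natr_sum; apply: ler_sum => u _; rewrite natr_sum; apply: ler_sum => v _.
    by rewrite !natrM.
  apply: le_trans w3X _; apply: le_trans Xchi _.
  have := ler_wpM2l (mulr_ge0 (ler0n R M) chi0) degm; lra.
have [->|dn0] := eqVneq d 0; first by rewrite expr0n mul0r.
have dp : 0 < d by rewrite lt_def dn0.
have [->|chin0] := eqVneq chi 0; first by rewrite mulr0 invr0 mulr0.
have chip : 0 < chi by rewrite lt_def chin0.
rewrite ler_pdivrMr ?mulr_gt0 //.
have degp : 0 < \sum_(u : G) (degree u)%:R :> R.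
  rewrite (bigD1 x) //= ltr_pwDl ?sumr_ge0 //; exact: lt_le_trans (degd x).
(* Multiplied by the degree sum, the claim passes through [X]: each [u] contributes at least
   [d * (degree u) ^ 2 >= d ^ 2 * degree u] to it. *)
rewrite -(ler_pM2r degp); apply: le_trans (_ : X <= _); last by apply: le_trans Xchi _; lra.
rewrite mulr_sumr; apply: ler_sum => u _.
have du := degd u; have du0 := le_trans d0 du.
apply: (@le_trans _ _ (\sum_(v | adj u v) (degree u)%:R * d)).
  rewrite sumr_const (_ : #|_| = degree u); last by apply: eq_card => v; rewrite !inE.
  rewrite -[leRHS]mulr_natl expr2 [leRHS](_ : _ = (degree u)%:R * d * (degree u)%:R); last by ring.
  by rewrite ler_wpM2r // ler_wpM2r.
rewrite big_mkcond; apply: ler_sum => v _; case: (adj u v); rewrite ?mul0r // mul1r.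
by rewrite ler_wpM2l.
Qed.
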